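(* Let $\mathcal{U} = (u_1,\ldots,u_m)$ be a complete increasing sequence of positive integers with $U = \sum_{j=1}^m u_j$. Consider the linear form $f(x_1,\ldots,x_m) = u_1x_1 + \cdots + u_m x_m$. Then $$N_f(k) = Uk-U+1,$$ and the set $A$ is a minimizing $k$-set for $f$ if and only if $A$ is an arithmetic progression of length $k$.
   Context: Here $m \geq 1$ is an integer and $k$ is a positive integer. A finite sequence $(u_1,\ldots,u_m)$ of positive integers with $U=\sum_{j=1}^m u_j$ is called complete if $\left\{\sum_{j\in J} u_j : J \subseteq \{1,\ldots,m\}\right\} = \{0,1,2,\ldots,U\}$. ''Increasing'' means $u_1 \leq u_2 \leq \cdots \leq u_m$ (repeated terms are allowed). For a function $f:\mathbf{Z}^m\to\mathbf{R}$ and a finite set $A\subseteq\mathbf{Z}$, let $f(A)=\{f(a_1,\ldots,a_m): a_1,\ldots,a_m\in A\}$, and let $N_f(k)=\min\{|f(A)| : A\subseteq\mathbf{Z},\ |A|=k\}$, where $|\cdot|$ denotes cardinality. A set $A\subseteq \mathbf{Z}$ with $|A|=k$ is called a minimizing $k$-set for $f$ if $|f(A)|=N_f(k)$. An arithmetic progression of length $k$ is a set of the form $\{a, a+d, \ldots, a+(k-1)d\}$ with $a,d$ integers, $d\neq 0$.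
   Formalization: That every minimizing k-set is an arithmetic progression is asserted only for m ≥ 2 or k ≤ 2; for m = 1 the form is f(x) = x, every k-set is minimizing, and {0,1,3} shows the claim fails when k ≥ 3. *)

(* Defs.v *)
From HB Require Import structures.
From mathcomp Require Import all_boot all_order all_algebra finmap.
From mathcomp Require Import boolp.

Set Implicit Arguments.
Unset Strict Implicit.
Unset Printing Implicit Defensive.

Import Order.TTheory GRing.Theory Num.Theory.

Local Open Scope fset_scope.
Local Open Scope ring_scope.

Definition positive_seq (m : nat) (u : 'I_m -> nat) : Prop :=
  forall j : 'I_m, (0 < u j)%N.

Definition increasing_seq (m : nat) (u : 'I_m -> nat) : Prop :=
  forall i j : 'I_m, (i <= j)%N -> (u i <= u j)%N.

Definition seq_sum (m : nat) (u : 'I_m -> nat) : nat := (\sum_(j < m) u j)%N.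

Definition complete_seq (m : nat) (u : 'I_m -> nat) : Prop :=
  forall n : nat,
    (exists J : {set 'I_m}, (\sum_(j in J) u j)%N = n) <-> (n <= seq_sum u)%N.

Definition linear_form (m : nat) (u : 'I_m -> nat) (x : {ffun 'I_m -> int}) :
    int :=
  \sum_(j < m) (u j)%:Z * x j.

(* The tuples with entries in A are the finite functions into the finite
   subtype of int attached to A. *)
Definition image_of (m : nat) (T : choiceType) (f : {ffun 'I_m -> int} -> T)
    (A : {fset int}) : {fset T} :=
  [fset f [ffun j => val (a j)] | a : {ffun 'I_m -> A} in {: {ffun 'I_m -> A}}].

Definition is_image_card (m : nat) (T : choiceType)
    (f : {ffun 'I_m -> int} -> T) (k n : nat) : Prop :=
  exists2 A : {fset int}, #|` A| = k & #|` image_of f A| = n.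

Lemma exists_image_card (m : nat) (T : choiceType)
    (f : {ffun 'I_m -> int} -> T) (k : nat) :
  exists n : nat, `[< is_image_card f k n >].
Proof.
pose A : {fset int} := [fset i%:Z | i in iota 0 k].
exists #|` image_of f A|; apply/asboolP; exists A => //.
rewrite /A card_imfset /=; last by move=> i j [].
by rewrite undup_id ?size_iota ?iota_uniq.
Qed.

Definition min_card (m : nat) (T : choiceType)
    (f : {ffun 'I_m -> int} -> T) (k : nat) : nat :=
  ex_minn (exists_image_card f k).

Definition minimizing_set (m : nat) (T : choiceType)
    (f : {ffun 'I_m -> int} -> T) (k : nat) (A : {fset int}) : Prop :=
  #|` A| = k /\ #|` image_of f A| = min_card f k.

Definition is_AP (k : nat) (A : {fset int}) : Prop :=
  exists a d : int, d != 0 /\ A = [fset a + i%:Z * d | i in iota 0 k].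

(* Main.v *)
Require Import Defs.
From mathcomp Require Import all_boot all_order all_algebra finmap.
From mathcomp Require Import boolp zify ring.

Set Implicit Arguments.
Unset Strict Implicit.
Unset Printing Implicit Defensive.

Import Order.TTheory GRing.Theory Num.Theory.

Local Open Scope fset_scope.
Local Open Scope ring_scope.

(** Let [U] be the sum of the coefficients and list [A] increasingly as
    [g 0 < ... < g k], with [k + 1] elements.  Completeness says that every
    [r <= U] is the sum of the [u j] over some set [J] of indices; giving the
    value [g (q + 1)] to the variables in [J] and [g q] to the others shows
    that the form takes the value [U * g q + r * (g (q + 1) - g q)].  So the
    image of [A] contains the points that cut each interval
    [[U * g q, U * g (q + 1)]] into [U] equal parts ([subdiv_point_in_image]).
    These are [U * k + 1] distinct points, whence the lower bound
    ([image_card_ge]).  For an arithmetic progression the image lies in an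
    arithmetic progression of that length, so the bound is attained
    ([image_card_AP]).

    Conversely, if the bound is attained, the image consists of the
    subdivision points only.  Suppose that two consecutive gaps
    [d = g (i + 1) - g i] and [d' = g (i + 2) - g (i + 1)] differ.  By
    completeness some coefficient is 1; let [w] be another coefficient, and set
    all remaining variables to [b = g (i + 1)].  If [d < d'], moving the variable
    of coefficient 1 down to [g i] and that of coefficient [w] up to [g (i + 2)]
    gives the value [U * b + w * d' - d], strictly between the consecutive
    subdivision points [U * b + (w - 1) * d'] and [U * b + w * d'].  If [d' < d],
    the mirror image gives [U * b - w * d + d'], strictly between
    [U * b - w * d] and [U * b - (w - 1) * d].  Either way the image has an
    extra point ([gap_step_eq]).  Hence all gaps agree and [A] is an arithmetic
    progression.  With a single variable there is no second coefficient,
    but a set with at most two elements is always a progression. *)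

(** * Increasing sequences of integers *)

Lemma lt_of_lt_succ (h : nat -> int) (N : nat) :
  (forall i, (i < N)%N -> h i < h i.+1) ->
  forall i j, (i < j)%N -> (j <= N)%N -> h i < h j.
Proof.
move=> hS i; elim=> [//|j IHj]; rewrite ltnS leq_eqVlt.
case/predU1P=> [-> | ltij] ltjN; first exact: hS.
by apply: lt_trans (hS _ ltjN); apply: IHj => //; apply: ltnW.
Qed.

Lemma uniq_map_of_lt_succ (h : nat -> int) (N : nat) :
  (forall i, (i < N)%N -> h i < h i.+1) -> uniq (map h (iota 0 N.+1)).
Proof.
move=> hS; rewrite map_inj_in_uniq ?iota_uniq // => i j.
rewrite !mem_iota !add0n !ltnS /= => leiN lejN eqh.
by case: (ltngtP i j) => // [lt|gt];
  [have := lt_of_lt_succ hS lt lejN | have := lt_of_lt_succ hS gt leiN];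
  rewrite eqh ltxx.
Qed.

Lemma gap_notin_map (h : nat -> int) (N n : nat) (y : int) :
  (forall i, (i < N)%N -> h i < h i.+1) ->
  (n < N)%N -> h n < y -> y < h n.+1 -> y \notin map h (iota 0 N.+1).
Proof.
move=> hS ltnN hny yhn; apply/mapP => -[i].
rewrite mem_iota add0n ltnS /= => leiN yE; rewrite {y}yE in hny yhn.
have [lein | ltni] := leqP i n.
  case: (ltngtP i n) lein => // [lt _ | eqin _].
    by have := lt_trans hny (lt_of_lt_succ hS lt (ltnW ltnN)); rewrite ltxx.
  by rewrite eqin ltxx in hny.
case: (ltngtP n.+1 i) ltni => // [lt _ | eqin _].
  by have := lt_trans yhn (lt_of_lt_succ hS lt leiN); rewrite ltxx.
by rewrite eqin ltxx in yhn.
Qed.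

(** Indexing by [nat] instead of by ordinals avoids casts when successive
    elements are compared; the values of [g] beyond the cardinal of [A] are
    arbitrary. *)
Lemma fset_increasing_enum (A : {fset int}) :
  exists2 g : nat -> int,
    (forall i j, (i < j)%N -> (j < #|` A|)%N -> g i < g j) &
    A = [fset g i | i in iota 0 #|` A|].
Proof.
pose s := sort <=%R (enum_fset A).
have szs : size s = #|` A| by rewrite size_sort.
have ss : sorted <%R s by rewrite sort_lt_sorted fset_uniq.
exists (nth 0 s) => [i j ltij ltj|].
  by rewrite lt_sorted_ltn_nth ?inE ?szs // (ltn_trans ltij).
apply/fsetP => x; rewrite -(mem_sort <=%R) -/s; apply/idP/imfsetP => /=.
  move=> xs; exists (index x s); last by rewrite nth_index.
  by rewrite mem_iota add0n -szs index_mem.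
by case=> i; rewrite mem_iota add0n /= -szs => lti ->; apply: mem_nth.
Qed.

Lemma enum_mem (g : nat -> int) (k i : nat) (A : {fset int}) :
  A = [fset g i | i in iota 0 k.+1] -> (i <= k)%N -> g i \in A.
Proof.
move=> -> lei; apply/imfsetP => /=; exists i => //.
by rewrite inE mem_iota; lia.
Qed.

Lemma card_AP (k : nat) (A : {fset int}) : is_AP k A -> #|` A| = k.
Proof.
case=> a [d [d0 ->]]; rewrite card_imfset /=.
  by rewrite undup_id ?size_iota ?iota_uniq.
by move=> i j /addrI /(mulIf d0) [].
Qed.

(** * Values of the linear form *)

Section LinearForm.

Variables (m : nat) (u : 'I_m -> nat).

Notation U := (seq_sum u).

Lemma linear_form_in_image (A : {fset int}) (x : 'I_m -> int) :
  (forall j, x j \in A) ->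
  \sum_(j < m) (u j)%:Z * x j \in image_of (linear_form u) A.
Proof.
move=> xA; apply/imfsetP; exists [ffun j => [` xA j]] => //=.
by apply: eq_bigr => j _; rewrite !ffunE.
Qed.

Lemma sum_form_const (b : int) : \sum_(j < m) (u j)%:Z * b = U%:Z * b.
Proof.
rewrite -mulr_suml /seq_sum -natz natr_sum; congr (_ * _).
by apply: eq_bigr => j _; rewrite natz.
Qed.

Lemma sum_form_subset (J : {set 'I_m}) (b c : int) :
  \sum_(j < m) (u j)%:Z * (if j \in J then c else b)
  = U%:Z * b + (\sum_(j in J) u j)%N%:Z * (c - b).
Proof.
rewrite -sum_form_const -[(\sum_(j in J) _)%N%:Z]natz natr_sum mulr_suml.
rewrite [X in _ + X]big_mkcond -big_split /=; apply: eq_bigr => j _.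
by rewrite natz; case: ifP => _; ring.
Qed.

Lemma sum_form_pair (j0 j1 : 'I_m) (b c0 c1 : int) : j1 != j0 ->
  \sum_(j < m) (u j)%:Z * (if j == j0 then c0 else if j == j1 then c1 else b)
  = U%:Z * b + (u j0)%:Z * (c0 - b) + (u j1)%:Z * (c1 - b).
Proof.
move=> neq; rewrite -sum_form_const.
rewrite (bigD1 j0) //= (bigD1 j1) //= [in RHS](bigD1 j0) //= [in RHS](bigD1 j1) //=.
rewrite !eqxx (negPf neq).
under eq_bigr => j /andP[/negPf -> /negPf ->] do [].
ring.
Qed.

(** * The subdivision points and the minimal cardinality *)

(** The points cutting each [[U * g q, U * g q.+1]] into [U] equal parts,
    numbered consecutively: point number [q * U + r] is the [r]-th one after
    [U * g q]. *)
Definition subdiv_point (g : nat -> int) (n : nat) : int :=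
  U%:Z * g (n %/ U)%N + (n %% U)%N%:Z * (g (n %/ U)%N.+1 - g (n %/ U)%N).

(** The case [r = U] is allowed: the last point of one interval is the first
    point of the next one. *)
Lemma subdiv_pointE (g : nat -> int) (q r : nat) : (0 < U)%N -> (r <= U)%N ->
  subdiv_point g (q * U + r)%N = U%:Z * g q + r%:Z * (g q.+1 - g q).
Proof.
move=> U0; rewrite /subdiv_point leq_eqVlt => /predU1P[->|ltr].
  rewrite -mulSnr mulnK // modnMl; ring.
by rewrite divnMDl // modnMDl divn_small // modn_small // addn0.
Qed.

Hypothesis u_pos : positive_seq u.
Hypothesis u_complete : complete_seq u.

Lemma subdiv_point_lt (g : nat -> int) (k : nat) : (0 < U)%N ->
  (forall i j, (i < j)%N -> (j < k.+1)%N -> g i < g j) ->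
  forall n, (n < U * k)%N -> subdiv_point g n < subdiv_point g n.+1.
Proof.
move=> U0 gS n ltn; have ltq : (n %/ U < k)%N by rewrite ltn_divLR // mulnC.
have gq := gS _ _ (ltnSn (n %/ U)%N) ltq.
have ltr := ltn_pmod n U0.
rewrite (divn_eq n U) -addnS !subdiv_pointE ?(ltnW ltr) //.
rewrite -subr_gt0 (_ : _ - _ = g (n %/ U)%N.+1 - g (n %/ U)%N) ?subr_gt0 //.
rewrite -[(n %% U)%N.+1]addn1 PoszD; ring.
Qed.

(** A subset of the indices with coefficient sum [r], which completeness
    supplies, selects the variables that take the upper value [g q.+1]. *)
Lemma subdiv_point_in_image (g : nat -> int) (k n : nat) (A : {fset int}) :
  (0 < U)%N -> A = [fset g i | i in iota 0 k.+1] -> (n <= U * k)%N ->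
  subdiv_point g n \in image_of (linear_form u) A.
Proof.
move=> U0 AE len.
have gA i : (i <= k)%N -> g i \in A by apply: enum_mem.
have leq : (n %/ U <= k)%N by rewrite -(mulKn k U0) leq_div2r.
have ltr := ltn_pmod n U0.
have [J sJ] := (u_complete (n %% U)%N).2 (ltnW ltr).
rewrite /subdiv_point; have [eqk | neqk] := eqVneq (n %/ U)%N k.
  (* Only the last point, where the unspecified [g k.+1] has coefficient 0. *)
  have -> : (n %% U = 0)%N.
    by move: (divn_eq n U) len; rewrite eqk mulnC; lia.
  by rewrite mul0r addr0 -sum_form_const linear_form_in_image // => _; apply: gA.
rewrite -sJ -sum_form_subset; apply: linear_form_in_image => j.
by case: ifP => _; apply: gA => //; rewrite ltn_neqAle neqk.
Qed.

Lemma image_card_ge (k : nat) (A : {fset int}) : (0 < U)%N ->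
  #|` A| = k.+1 -> ((U * k).+1 <= #|` image_of (linear_form u) A|)%N.
Proof.
move=> U0 cA; have [g gS AE] := fset_increasing_enum A; rewrite cA in gS AE.
rewrite -[(U * k).+1](size_iota 0) -(size_map (subdiv_point g)).
apply: uniq_leq_size; first exact/uniq_map_of_lt_succ/subdiv_point_lt.
move=> _ /mapP[n + ->]; rewrite mem_iota add0n ltnS /= => len.
exact: subdiv_point_in_image AE len.
Qed.

(** A value falling strictly between two consecutive subdivision points is a
    point of the image over and above the [U * k + 1] subdivision points. *)
Lemma image_card_gt (k n : nat) (g : nat -> int) (A : {fset int}) (y : int) :
  (0 < U)%N ->
  (forall i j, (i < j)%N -> (j < k.+1)%N -> g i < g j) ->
  A = [fset g i | i in iota 0 k.+1] ->
  (n < U * k)%N -> subdiv_point g n < y -> y < subdiv_point g n.+1 ->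
  y \in image_of (linear_form u) A ->
  ((U * k).+1 < #|` image_of (linear_form u) A|)%N.
Proof.
move=> U0 gS AE ltn ny yn yA; have hS := subdiv_point_lt U0 gS.
pose s := y :: map (subdiv_point g) (iota 0 (U * k).+1).
have <- : size s = (U * k).+2 by rewrite /= size_map size_iota.
apply: uniq_leq_size; rewrite {}/s.
  by rewrite cons_uniq (gap_notin_map hS ltn) // uniq_map_of_lt_succ.
move=> z; rewrite inE => /predU1P[-> // | /mapP[i]].
rewrite mem_iota add0n ltnS /= => lei ->.
exact: subdiv_point_in_image AE lei.
Qed.

(** The value at [x j = a + e j * d] is [U * a + (\sum_j u j * e j) * d], and
    the sum of the [u j * e j] is at most [U * k]. *)
Lemma image_card_AP_le (k : nat) (A : {fset int}) :
  is_AP k.+1 A -> (#|` image_of (linear_form u) A| <= (U * k).+1)%N.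
Proof.
case=> a [d [_ AE]].
rewrite -[(U * k).+1](size_iota 0) -(size_map (fun n : nat => U%:Z * a + n%:Z * d)).
apply: uniq_leq_size; first exact: fset_uniq.
move=> _ /imfsetP[x _ ->].
have xA j : exists i : 'I_k.+1, val (x j) == a + i%:Z * d.
  move: (val (x j)) (valP (x j)) => z; rewrite AE => /imfsetP[i /=].
  rewrite inE mem_iota => rng ->; have lti : (i < k.+1)%N by lia.
  by exists (Ordinal lti).
pose e j := xchoose (xA j).
apply/mapP; exists (\sum_(j < m) u j * e j)%N.
  rewrite mem_iota add0n ltnS /= /seq_sum big_distrl /=.
  by apply: leq_sum => j _; rewrite leq_mul2l -ltnS ltn_ord orbT.
rewrite -sum_form_const -[(\sum_(j < m) u j * e j)%N%:Z]natz natr_sum mulr_suml.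
rewrite -big_split; apply: eq_bigr => j _ /=.
rewrite !ffunE (eqP (xchooseP (xA j))) -/(e j) natz PoszM; ring.
Qed.

Lemma image_card_AP (k : nat) (A : {fset int}) : (0 < U)%N ->
  is_AP k.+1 A -> #|` image_of (linear_form u) A| = (U * k).+1.
Proof.
move=> U0 AP; apply/eqP; rewrite eqn_leq image_card_AP_le //.
exact/image_card_ge/card_AP.
Qed.

Lemma min_cardE (k : nat) : (0 < U)%N ->
  min_card (linear_form u) k.+1 = (U * k).+1.
Proof.
move=> U0; pose A := [fset 0 + i%:Z * 1 | i in iota 0 k.+1] : {fset int}.
have AP : is_AP k.+1 A by exists 0, 1.
rewrite /min_card; case: ex_minnP => n /asboolP[B cB <-] nmin.
apply/eqP; rewrite eqn_leq image_card_ge // andbT.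
by apply: nmin; apply/asboolP; exists A; [apply: card_AP | apply: image_card_AP].
Qed.

(** * Sets attaining the minimum *)

Lemma exists_unit_coef : (0 < U)%N -> exists j, u j = 1%N.
Proof.
move=> U0; have [J sJ] := (u_complete 1%N).2 U0.
have [J0 | [j jJ]] := set_0Vmem J; first by rewrite J0 big_set0 in sJ.
exists j; apply/eqP; rewrite eqn_leq u_pos andbT -sJ (bigD1 j jJ) /=.
exact: leq_addr.
Qed.

(** If the gaps differed, moving one variable of coefficient 1 and one other
    variable from [g i.+1] in opposite directions, the second one across the
    larger gap, would give a value that is not a subdivision point. *)
Lemma gap_step_eq (k i : nat) (g : nat -> int) (A : {fset int}) :
  (1 < m)%N ->
  (forall i j, (i < j)%N -> (j < k.+1)%N -> g i < g j) ->
  A = [fset g i | i in iota 0 k.+1] ->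
  #|` image_of (linear_form u) A| = (U * k).+1 ->
  (i.+1 < k)%N -> g i.+2 - g i.+1 = g i.+1 - g i.
Proof.
move=> m1 gS AE cA ltik.
have gA q : (q <= k)%N -> g q \in A by apply: enum_mem.
have leU j : (u j <= U)%N by rewrite /seq_sum (bigD1 j) //= leq_addr.
have U0 : (0 < U)%N := leq_trans (u_pos (Ordinal (ltnW m1))) (leU _).
have [j0 uj0] := exists_unit_coef U0.
have [j1 neq] : exists j1, j1 != j0.
  have /card_gt1P[a [b [_ _ ab]]] : (1 < #|'I_m|)%N by rewrite card_ord.
  by have [eqa | ?] := eqVneq a j0; [exists b; rewrite -eqa eq_sym | exists a].
have w0 := u_pos j1; have wU := leU j1; set w := u j1 in w0 wU.
have no_gap n y : (n < U * k)%N -> subdiv_point g n < y ->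
    y < subdiv_point g n.+1 -> y \in image_of (linear_form u) A -> False.
  by move=> ltn ny yn /(image_card_gt U0 gS AE ltn ny yn); rewrite cA ltnn.
have gap_in (c0 c1 : int) : c0 \in A -> c1 \in A ->
    U%:Z * g i.+1 + (c0 - g i.+1) + w%:Z * (c1 - g i.+1)
      \in image_of (linear_form u) A.
  move=> c0A c1A; rewrite -[c0 - _]mul1r -[X in X%:Z * (c0 - _)]uj0.
  rewrite -(sum_form_pair _ _ _ neq); apply: linear_form_in_image => j.
  by case: ifP => // _; case: ifP => // _; apply: gA; lia.
have g1 : g i < g i.+1 by apply: gS; lia.
have g2 : g i.+1 < g i.+2 by apply: gS; lia.
have [ | | //] := ltgtP (g i.+2 - g i.+1) (g i.+1 - g i) => cmp; exfalso.
- apply: (no_gap (i * U + (U - w))%N _ _ _ _ (gap_in (g i.+2) (g i) _ _)).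
  (* [U * g i.+1 - w * (g i.+1 - g i)] is the point [U - w] after [U * g i]. *)
  + nia.
  + rewrite subdiv_pointE ?leq_subr //; nia.
  + rewrite -addnS subdiv_pointE //; last lia. nia.
  + by apply: gA.
  + by apply: gA; lia.
- apply: (no_gap (i.+1 * U + w.-1)%N _ _ _ _ (gap_in (g i) (g i.+2) _ _)).
  + nia.
  + rewrite subdiv_pointE //; last lia. nia.
  + rewrite -addnS prednK // subdiv_pointE //. nia.
  + by apply: gA; lia.
  + by apply: gA.
Qed.

Lemma is_AP_of_image_card (k : nat) (A : {fset int}) :
  (1 < m)%N \/ (k <= 1)%N -> #|` A| = k.+1 ->
  #|` image_of (linear_form u) A| = (U * k).+1 -> is_AP k.+1 A.
Proof.
move=> mk cA cI; have [g gS AE] := fset_increasing_enum A.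
rewrite cA in gS AE.
(* A single point is a progression of any nonzero difference. *)
pose d := if k is 0 then 1 else g 1%N - g 0%N.
have step i : (i < k)%N -> g i.+1 - g i = d.
  elim: i => [|i IHi] ltik; first by rewrite /d; case: k ltik {mk cA cI gS AE d}.
  rewrite -IHi ?(ltnW ltik) //; case: mk => [m1 | k1]; last lia.
  exact: gap_step_eq m1 gS AE cI ltik.
exists (g 0%N), d; split.
  rewrite /d; case: k gS {mk cA cI AE d step} => // k gS.
  by rewrite subr_eq0 gt_eqF // gS.
have gE i : (i <= k)%N -> g i = g 0%N + i%:Z * d.
  elim: i => [|i IHi] lei; first by rewrite mul0r addr0.
  by have := step _ lei; rewrite IHi ?(ltnW lei) //; lia.
rewrite [LHS]AE; apply: eq_in_imfset => //= i.
by rewrite inE mem_iota => rng; apply: gE; lia.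
Qed.

End LinearForm.

Theorem theorem4 (m k : nat) (u : 'I_m -> nat) :
  (1 <= m)%N -> (1 <= k)%N ->
  positive_seq u -> increasing_seq u -> complete_seq u ->
  min_card (linear_form u) k = (seq_sum u * k - seq_sum u + 1)%N
  /\ (forall A : {fset int},
        is_AP k A -> minimizing_set (linear_form u) k A)
  /\ ((2 <= m)%N \/ (k <= 2)%N ->
      forall A : {fset int},
        minimizing_set (linear_form u) k A -> is_AP k A).
Proof.
move=> m1; case: k => // k _ u_pos _ u_complete.
have U0 : (0 < seq_sum u)%N.
  rewrite /seq_sum (bigD1 (Ordinal m1)) //=.
  by apply: leq_trans (u_pos _) (leq_addr _ _).
have minE := min_cardE u_complete k U0.
split; first by rewrite minE mulnS addKn addn1.
split=> [A AP | mk A [cA cI]].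
  by split; [apply: card_AP | rewrite minE (image_card_AP u_complete U0 AP)].
by apply: (is_AP_of_image_card u_pos u_complete mk cA); rewrite cI.
Qed.
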